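(* For every integer $n\ge 3$ there is an instance of Min Max Disagreements on $n$ vertices (an unweighted graph, i.e. all weights equal to $1$) such that the minimum over all clusterings of $\max_{u\in V}\mathrm{disagree}_{\mathcal S}(u)$ is at least $\frac n2$ times the optimal value of the natural LP relaxation, and also at least $\frac n2$ times the optimal value of the natural SDP relaxation. That is, both the natural LP and the natural SDP relaxations of Min Max Disagreements have integrality gap (at least) $n/2$.
   Context: An instance of Correlation Clustering consists of an undirected graph $G=(V,E)$, $n=|V|$, non-negative edge weights $c:E\to\mathbb R_{\ge 0}$, and a partition of $E$ into $E^+$ (''$+$'' edges) and $E^-$ (''$-$'' edges). A clustering is a partition $\mathcal S=\{S_1,\dots,S_\ell\}$ of $V$ into an arbitrary number of parts. For $u\in S_i$, $\mathrm{disagree}_{\mathcal S}(u)=\sum_{v\notin S_i,(u,v)\in E^+}c_{u,v}+\sum_{v\in S_i,(u,v)\in E^-}c_{u,v}$. Min Max Disagreements asks for a clustering minimizing $\max_{u\in V}\mathrm{disagree}_{\mathcal S}(u)$. The natural LP relaxation: minimize $\max_{u\in V}D(u)$ subject to $D(u)=\sum_{v:(u,v)\in E^+}c_{u,v}d(u,v)+\sum_{v:(u,v)\in E^-}c_{u,v}(1-d(u,v))$ for all $u$; $d(u,v)+d(v,w)\ge d(u,w)$ for all $u,v,w\in V$; $D(u)\ge 0$ and $0\le d(u,v)\le 1$ for all $u,v$. The natural SDP relaxation: assign to each $u\in V$ a vector $y_u$ with $y_u\cdot y_u=1$, $y_u\cdot y_v\ge 0$ for all $u,v$, and $\|y_u-y_v\|_2^2+\|y_v-y_w\|_2^2\ge\|y_u-y_w\|_2^2$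 for all $u,v,w$; minimize $\max_u D(u)$ where $D(u)=\sum_{v:(u,v)\in E^+}c_{u,v}(1-y_u\cdot y_v)+\sum_{v:(u,v)\in E^-}c_{u,v}\,y_u\cdot y_v$. *)

(* Defs.v *)
From HB Require Import structures.
From mathcomp Require Import all_boot all_order all_algebra.
From mathcomp Require Import all_classical all_reals ereal.

Set Implicit Arguments.
Unset Strict Implicit.
Unset Printing Implicit Defensive.
Import Order.TTheory GRing.Theory Num.Theory.
Local Open Scope classical_set_scope.
Local Open Scope ring_scope.

(* The edge set E is the disjoint union of [plus] and [minus]; the values of
   [weight] on non-edges are never used. *)
Record instance (R : realType) (V : finType) := Instance {
  plus : rel V;
  minus : rel V;
  weight : V -> V -> R;
  plus_sym : symmetric plus;
  minus_sym : symmetric minus;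
  plus_irr : irreflexive plus;
  minus_irr : irreflexive minus;
  plus_minus_disj : forall u v, ~~ (plus u v && minus u v);
  weight_sym : forall u v, weight u v = weight v u;
  weight_ge0 : forall u v, plus u v || minus u v -> 0 <= weight u v
}.

Section Problem.
Context {R : realType} {V : finType}.
Implicit Type I : instance R V.

Definition edge I : rel V := fun u v => plus I u v || minus I u v.

Definition unweighted I : Prop := forall u v, edge I u v -> weight I u v = 1.

(* The default value 0 is harmless: it is applied only to nonnegative [f]. *)
Definition max_over (f : V -> R) : R := \big[Num.max/0]_(u : V) f u.

(* [partition] and [pblock] are qualified because mathcomp-classical shadows the
   finite-set versions. *)
Definition clustering (S : {set {set V}}) : Prop := finset.partition S [set: V]%SET.

Definition disagree I (S : {set {set V}}) (u : V) : R :=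
  \sum_(v | (v \notin finset.pblock S u) && plus I u v) weight I u v
  + \sum_(v | (v \in finset.pblock S u) && minus I u v) weight I u v.

(* Optimal values are infima in the extended reals, so that an empty feasible
   set would have optimal value +oo rather than a default real number. *)
Definition opt I : \bar R :=
  ereal_inf [set (max_over (disagree I S))%:E | S in [set S | clustering S]].

Definition lp_cost I (d : V -> V -> R) (u : V) : R :=
  \sum_(v | plus I u v) weight I u v * d u v
  + \sum_(v | minus I u v) weight I u v * (1 - d u v).

(* Symmetry expresses that there is one variable per unordered pair. *)
Record lp_feasible I (d : V -> V -> R) : Prop := LPFeasible {
  lp_sym : forall u v, d u v = d v u;
  lp_triangle : forall u v w, d u w <= d u v + d v w;
  lp_bounds : forall u v, 0 <= d u v <= 1;
  lp_cost_ge0 : forall u, 0 <= lp_cost I d u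
}.

Definition lp_opt I : \bar R :=
  ereal_inf [set (max_over (lp_cost I d))%:E | d in [set d | lp_feasible I d]].

Definition dot (m : nat) (x y : 'rV[R]_m) : R := \sum_(i < m) x 0 i * y 0 i.

(* The library norm on row vectors is the sup norm, hence this definition. *)
Definition sqdist (m : nat) (x y : 'rV[R]_m) : R := dot (x - y) (x - y).

Definition sdp_cost I (m : nat) (y : V -> 'rV[R]_m) (u : V) : R :=
  \sum_(v | plus I u v) weight I u v * (1 - dot (y u) (y v))
  + \sum_(v | minus I u v) weight I u v * dot (y u) (y v).

Record sdp_feasible (m : nat) (y : V -> 'rV[R]_m) : Prop := SDPFeasible {
  sdp_unit : forall u, dot (y u) (y u) = 1;
  sdp_dot_ge0 : forall u v, 0 <= dot (y u) (y v);
  sdp_triangle : forall u v w,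
    sqdist (y u) (y w) <= sqdist (y u) (y v) + sqdist (y v) (y w)
}.

(* The dimension m of the vectors is not fixed in advance. *)
Definition sdp_opt I : \bar R :=
  ereal_inf [set x | exists (m : nat) (y : V -> 'rV[R]_m),
    sdp_feasible y /\ x = (max_over (sdp_cost I y))%:E].

End Problem.

(* Main.v *)
(** The instance is the [n]-cycle 0, 1, ..., n-1 in which the edge {0, n-1} is
    the only minus edge.  Going around the cycle, every clustering violates some
    edge, so its maximal disagreement is at least 1, and likewise no LP solution
    has cost 0 at all vertices.  The unit vectors
    [y_u = n^(-1/2) 1_[u, u+n)] satisfy [y_u . y_v = 1 - |u - v| / n], so each of
    the two edges at a vertex contributes 1/n and the SDP value is at most 2/n.
    Since [d u v = 1 - y_u . y_v] turns SDP solutions into LP solutions of the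
    same cost, 2/n bounds the LP value as well. *)
Require Import Defs.
From mathcomp Require Import all_boot all_order all_algebra.
From mathcomp Require Import all_classical all_reals ereal.
From mathcomp Require Import zify ring lra.
Import Order.TTheory GRing.Theory Num.Theory.
Local Open Scope ring_scope.
Local Open Scope ereal_scope.

(** * Clusterings and SDP solutions as points of the LP *)

Section Relaxations.
Local Open Scope ring_scope.
Context {R : realType} {V : finType}.
Implicit Types (I : instance R V) (d : V -> V -> R).

Lemma le_max_over (f : V -> R) (u : V) : f u <= max_over f.
Proof. exact: le_bigmax. Qed.

Lemma lp_terms_ge0 I d : (forall u v, 0 <= d u v <= 1) ->
  forall u v, (plus I u v -> 0 <= weight I u v * d u v) /\
              (minus I u v -> 0 <= weight I u v * (1 - d u v)).
Proof.
move=> d01 u v; have /andP[d0 d1] := d01 u v.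
by split=> e; rewrite mulr_ge0 ?subr_ge0 ?weight_ge0 ?e ?orbT.
Qed.

Lemma lp_cost_nonneg I d : (forall u v, 0 <= d u v <= 1) ->
  forall u, 0 <= lp_cost I d u.
Proof.
move=> /(lp_terms_ge0 I) t0 u.
by rewrite addr_ge0 // sumr_ge0 // => v e; apply t0.
Qed.

(** All terms of the cost are nonnegative, so any single edge bounds it from below. *)
Lemma lp_cost_ge_plus I d u v : (forall u v, 0 <= d u v <= 1) ->
  plus I u v -> weight I u v * d u v <= lp_cost I d u.
Proof.
move=> /(lp_terms_ge0 I) t0 uv.
rewrite /lp_cost (bigD1 v) //= -addrA lerDl addr_ge0 // sumr_ge0 // => w.
  by case/andP=> e _; apply t0.
by move=> e; apply t0.
Qed.

Lemma lp_cost_ge_minus I d u v : (forall u v, 0 <= d u v <= 1) ->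
  minus I u v -> weight I u v * (1 - d u v) <= lp_cost I d u.
Proof.
move=> /(lp_terms_ge0 I) t0 uv.
rewrite /lp_cost [leRHS]addrC (bigD1 v) //= -addrA lerDl addr_ge0 // sumr_ge0 // => w.
  by case/andP=> e _; apply t0.
by move=> e; apply t0.
Qed.

(** The integral LP point of a clustering; through it, facts about LP points apply to
    clusterings. *)
Definition cut_metric (S : {set {set V}}) (u v : V) : R :=
  (v \notin finset.pblock S u)%:R.

Lemma disagree_lp_cost I S u : disagree I S u = lp_cost I (cut_metric S) u.
Proof.
rewrite /disagree /lp_cost /cut_metric; congr (_ + _).
  rewrite big_mkcond [RHS]big_mkcond; apply: eq_bigr => v _.
  by case: (v \in _); case: plus; rewrite /= ?mulr1 ?mulr0.
rewrite big_mkcond [RHS]big_mkcond; apply: eq_bigr => v _.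
by case: (v \in _); case: minus; rewrite /= ?subrr ?subr0 ?mulr1 ?mulr0.
Qed.

(** Since the blocks cover [V] and are disjoint, the metric only tests whether two blocks differ, so
    symmetry and the triangle inequality come from those of equality. *)
Lemma cut_metric_feasible I S : clustering S -> lp_feasible I (cut_metric S).
Proof.
move=> /and3P[/eqP covS triS _].
have dE u v : cut_metric S u v = (finset.pblock S u != finset.pblock S v)%:R.
  by rewrite eq_pblock // covS finset.in_setT.
have d01 u v : 0 <= cut_metric S u v <= 1.
  by rewrite /cut_metric; case: (_ \notin _); rewrite ?lexx ?ler01.
split=> //; last exact: lp_cost_nonneg.
  by move=> u v; rewrite !dE eq_sym.
move=> u v w; rewrite !dE.
case: (eqVneq (finset.pblock S u) (finset.pblock S v)) => [->|_].
  by rewrite add0r.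
by case: (_ != _); case: (_ != _) => /=; lra.
Qed.

Lemma sqdistE m (x y : 'rV[R]_m) :
  sqdist x y = dot x x + dot y y - 2 * dot x y.
Proof.
rewrite /sqdist /dot mulr_sumr -sumrN -!big_split /=.
by apply: eq_bigr => i _; rewrite !mxE; ring.
Qed.

Lemma sqdist_unit m (y : V -> 'rV[R]_m) u v :
  (forall u, dot (y u) (y u) = 1) ->
  sqdist (y u) (y v) = 2 * (1 - dot (y u) (y v)).
Proof. by move=> y1; rewrite sqdistE !y1; ring. Qed.

Lemma dotC m (x y : 'rV[R]_m) : dot x y = dot y x.
Proof. by apply: eq_bigr => i _; rewrite mulrC. Qed.

(** For unit vectors [1 - dot (y u) (y v)] is half the squared distance: this gives the lower bound
    0 and the triangle inequality, while nonnegative dot products give the upper bound 1. *)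
Lemma sdp_lp_feasible I m (y : V -> 'rV[R]_m) : sdp_feasible y ->
  lp_feasible I (fun u v => 1 - dot (y u) (y v)).
Proof.
case=> y1 y0 yt.
have d01 u v : 0 <= 1 - dot (y u) (y v) <= 1.
  rewrite gerBl y0 andbT -(pmulr_rge0 _ (ltr0n R 2)) -sqdist_unit //.
  by rewrite sumr_ge0 // => i _; rewrite -expr2 sqr_ge0.
split=> //; last exact: lp_cost_nonneg.
  by move=> u v; rewrite dotC.
by move=> u v w; have := yt u v w; rewrite !sqdist_unit //; lra.
Qed.

Lemma sdp_lp_cost I m (y : V -> 'rV[R]_m) :
  sdp_cost I y = lp_cost I (fun u v => 1 - dot (y u) (y v)).
Proof.
apply/funext => u; congr (_ + _).
by apply: eq_bigr => v _; rewrite subKr.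
Qed.

Lemma lp_opt_le_sdp_opt I : (lp_opt I <= sdp_opt I)%E.
Proof.
apply/ereal_infP => _ [m [y [fy ->]]]; apply: ereal_inf_lbound.
exists (fun u v => 1 - dot (y u) (y v)); first exact: sdp_lp_feasible.
by rewrite sdp_lp_cost.
Qed.

End Relaxations.

(** * The cycle instance and its degrees *)

Section Cycle.
Local Open Scope ring_scope.
Context (R : realType) (n : nat) (n_ge3 : (3 <= n)%N).
Implicit Types u v : 'I_n.

Definition path_edge : rel 'I_n :=
  fun u v => (v == u.+1 :> nat) || (u == v.+1 :> nat).

Definition closing_edge : rel 'I_n := fun u v =>
  (u == 0 :> nat) && (v == n.-1 :> nat) || (u == n.-1 :> nat) && (v == 0 :> nat).

Fact path_edge_sym : symmetric path_edge.
Proof. by move=> u v; rewrite /path_edge orbC. Qed.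

Fact closing_edge_sym : symmetric closing_edge.
Proof. by move=> u v; rewrite /closing_edge; lia. Qed.

Fact path_edge_irr : irreflexive path_edge.
Proof. by move=> u; rewrite /path_edge; lia. Qed.

Fact closing_edge_irr : irreflexive closing_edge.
Proof. by move=> u; rewrite /closing_edge; lia. Qed.

Fact path_closing_disj u v : ~~ (path_edge u v && closing_edge u v).
Proof. by rewrite /path_edge /closing_edge; lia. Qed.

Definition cycle_instance : instance R 'I_n :=
  @Instance R 'I_n path_edge closing_edge (fun _ _ => 1)
    path_edge_sym closing_edge_sym path_edge_irr closing_edge_irr
    path_closing_disj (fun _ _ => erefl) (fun _ _ _ => ler01).

(** The two edge classes are disjoint, so the sum counts all neighbours of [u]; each is its cyclic
    successor or predecessor. *)
Lemma card_cycle_edges u : (#|path_edge u| + #|closing_edge u| <= 2)%N.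
Proof.
rewrite -cardUI [X in (_ + X)%N]eq_card0 ?addn0; last first.
  by move=> v; apply/negbTE; apply: path_closing_disj.
have sub : [predU path_edge u & closing_edge u] \subset
    [set ordS u; ord_pred u]%SET.
  apply/fintype.subsetP => v; rewrite !inE -!val_eqE /= /in_mem /=.
  rewrite /path_edge /closing_edge.
  have lt_u := ltn_ord u; have lt_v := ltn_ord v.
  have -> : (u.+1 %% n = if u.+1 == n then 0 else u.+1)%N.
    by case: eqP => [->|ne]; rewrite ?modnn // modn_small //; lia.
  have -> : ((u + n).-1 %% n = if u == 0 :> nat then n.-1 else u.-1)%N.
    case: eqP => [->|ne]; first by rewrite add0n modn_small //; lia.
    by rewrite (_ : (u + n).-1 = u.-1 + n)%N ?modnDr ?modn_small //; lia.
  by case: ifP => ?; case: ifP => ?; lia.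
by rewrite (leq_trans (subset_leq_card sub)) // cards2; case: (_ != _).
Qed.

(** * Lower bounds for the LP and for clusterings *)

(** The triangle inequality is summed along the path 0, 1, ..., [u]. Vertex 0 is excluded because
    nothing forces [d u0 u0] to vanish. *)
Lemma path_metric_le (d : 'I_n -> 'I_n -> R) (e : R) (u0 : 'I_n) :
  u0 = 0 :> nat ->
  (forall u v w, d u w <= d u v + d v w) ->
  (forall u v, path_edge u v -> d u v <= e) ->
  forall u, (0 < u)%N -> d u0 u <= u%:R * e.
Proof.
move=> u00 tri de [[|k] lt_k] //= _; elim: k lt_k => [|k IH] lt_k.
  by rewrite mul1r; apply: de; rewrite /path_edge /= u00.
(* The path to [k.+2] is split at its predecessor [k.+1]. *)
apply: (le_trans (tri _ (Ordinal (ltnW lt_k)) _)).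
rewrite -[k.+2%:R]natr1 mulrDl mul1r lerD ?IH //.
by apply: de; rewrite /path_edge /= eqxx.
Qed.

Let n_gt0 : (0 < n)%N. Proof. by case: n n_ge3. Qed.
Let first : 'I_n := Ordinal n_gt0.
Let last_proof : (n.-1 < n)%N. Proof. by rewrite ltn_predL. Qed.
Let last : 'I_n := Ordinal last_proof.

Let closing : closing_edge first last.
Proof. by rewrite /closing_edge /= !eqxx. Qed.

Lemma cycle_plus_le (d : 'I_n -> 'I_n -> R) : lp_feasible cycle_instance d ->
  forall u v, path_edge u v -> d u v <= max_over (lp_cost cycle_instance d).
Proof.
move=> [_ _ d01 _] u v uv; apply: le_trans (le_max_over _ u).
by have := lp_cost_ge_plus cycle_instance d u v d01 uv; rewrite mul1r.
Qed.

Lemma cycle_minus_le (d : 'I_n -> 'I_n -> R) : lp_feasible cycle_instance d ->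
  1 - d first last <= max_over (lp_cost cycle_instance d).
Proof.
move=> [_ _ d01 _]; apply: le_trans (le_max_over _ first).
by have := lp_cost_ge_minus cycle_instance d first last d01 closing; rewrite mul1r.
Qed.

(** The [n - 1] path edges give [d first last <= (n - 1) * M], and the minus edge gives
    [1 - d first last <= M]; adding them yields [1 <= n * M]. *)
Lemma cycle_lp_ge (d : 'I_n -> 'I_n -> R) : lp_feasible cycle_instance d ->
  n%:R^-1 <= max_over (lp_cost cycle_instance d).
Proof.
move=> fd; set M := max_over _.
have := path_metric_le d M first erefl (lp_triangle fd) (cycle_plus_le _ fd) last.
rewrite /= -subn1 subn_gt0 (leq_trans _ n_ge3) // natrB // => /(_ isT) le_d.
have := cycle_minus_le _ fd; rewrite -/M => le_m.
rewrite -div1r ler_pdivrMr ?ltr0n //.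
by lra.
Qed.

(** If the maximum were below 1, no path edge would be cut, so [first] and [last] would share a
    cluster and the minus edge would cost 1. *)
Lemma cycle_disagree_ge S : clustering S ->
  1 <= max_over (disagree cycle_instance S).
Proof.
move=> cS; have fS := cut_metric_feasible cycle_instance _ cS.
rewrite (_ : disagree _ S = lp_cost cycle_instance (cut_metric S)); last first.
  by apply/funext => u; apply: disagree_lp_cost.
set M := max_over _; rewrite leNgt; apply/negP => M_lt1.
(* A cut metric takes only the values 0 and 1, so a value below 1 is 0. *)
have d0 u v : path_edge u v -> cut_metric S u v <= 0 :> R.
  move=> /(cycle_plus_le _ fS)/le_lt_trans/(_ M_lt1).
  by rewrite /cut_metric; case: (_ \notin _); rewrite ?ltxx ?lexx.
have := path_metric_le _ 0 first erefl (lp_triangle fS) d0 last.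
rewrite /= -subn1 subn_gt0 (leq_trans _ n_ge3) // mulr0 => /(_ isT) le_d.
by have := cycle_minus_le _ fS; rewrite -/M; lra.
Qed.

(** * An SDP solution of value at most 2/n *)

(** With [2 * n] coordinates, every interval [u, u+n) with u < n fits. *)
Definition interval_vector (u : 'I_n) : 'rV[R]_(2 * n) :=
  \row_(i < 2 * n) (if (u <= i < u + n)%N then (Num.sqrt n%:R)^-1 else 0).

(** For [u <= v] the supports overlap in [v, u+n), which has [n - (v - u)] elements, each
    contributing 1/n. *)
Lemma dot_interval_vector u v :
  dot (interval_vector u) (interval_vector v) = 1 - `|u%:R - v%:R| / n%:R.
Proof.
wlog le_uv : u v / (u <= v)%N.
  by move=> W; case/orP: (leq_total u v) => /W // E; rewrite dotC E distrC.
have nz : n%:R != 0 :> R by rewrite pnatr_eq0 -lt0n.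
have -> : dot (interval_vector u) (interval_vector v) =
    \sum_(0 <= i < 2 * n | (v <= i < u + n)%N) n%:R^-1.
  rewrite big_mkord [RHS]big_mkcond; apply: eq_bigr => i _; rewrite !mxE.
  case: ifP => ui; case: ifP => vi; rewrite ?mulr0 ?mul0r.
  - rewrite -invfM -expr2 sqr_sqrtr ?ler0n // ifT //; lia.
  - rewrite ifF //; lia.
  - rewrite ifF //; lia.
  - rewrite ifF //; lia.
have lt_v := ltn_ord v; have lt_u := ltn_ord u.
rewrite (eq_bigl (fun i => (i < u + n)%N && (v <= i)%N)); last first.
  by move=> i; rewrite andbC.
rewrite -(big_nat_widenl v 0 _ (fun i => (i < u + n)%N)) //.
rewrite -(big_nat_widen v (u + n) _ xpredT) /=; last by lia.
rewrite sumr_const_nat -[LHS]mulr_natl natrB; last by lia.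
rewrite natrD ler0_norm ?subr_le0 ?ler_nat //.
by field.
Qed.

(** Dot products are nonnegative as |u - v| < n; squared distances are 2/n times distances on the
    line. *)
Lemma interval_vector_feasible : sdp_feasible interval_vector.
Proof.
have n_pos : 0 < n%:R :> R by rewrite ltr0n.
have y1 u : dot (interval_vector u) (interval_vector u) = 1.
  by rewrite dot_interval_vector subrr normr0 mul0r subr0.
split=> // [u v|u v w].
  rewrite dot_interval_vector subr_ge0 ler_pdivrMr // mul1r.
  have := ltn_ord u; have := ltn_ord v; rewrite -!(ltr_nat R) => v_lt u_lt.
  have := ler0n R u; have := ler0n R v => v_ge u_ge.
  by rewrite ler_norml; apply/andP; split; lra.
rewrite !sqdist_unit // !dot_interval_vector !subKr -mulrDr -mulrDl.
rewrite ler_pM2l ?ltr0n // ler_pM2r ?invr_gt0 //.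
exact: ler_distD.
Qed.

Lemma interval_vector_cost :
  max_over (sdp_cost cycle_instance interval_vector) <= 2 / n%:R.
Proof.
have n_pos : 0 < n%:R :> R by rewrite ltr0n.
(* The side goal [0 <= 2 / n] comes from the default value 0 of the maximum. *)
apply: bigmax_le => [|u _]; first by rewrite divr_ge0 // ?ler0n // ltW.
rewrite sdp_lp_cost.
(* A path edge has |u - v| = 1, hence LP distance 1/n; the minus edge has |u - v| = n - 1, hence dot
   product 1/n. *)
have -> : lp_cost cycle_instance
    (fun u v => 1 - dot (interval_vector u) (interval_vector v)) u =
  (#|path_edge u| + #|closing_edge u|)%:R / n%:R.
  rewrite natrD mulrDl !mulr_natl -!sumr_const; congr (_ + _).
    apply: eq_bigr => v uv; rewrite mul1r dot_interval_vector subKr.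
    have -> : `|u%:R - v%:R| = 1 :> R; last by rewrite mul1r.
    case/orP: uv => /eqP ->; rewrite -natr1.
      by rewrite opprD addrA subrr sub0r normrN1.
    by rewrite addrAC subrr add0r normr1.
  apply: eq_bigr => v uv; rewrite mul1r dot_interval_vector subKr.
  have -> : `|u%:R - v%:R| = n%:R - 1 :> R; last by field; rewrite gt_eqF.
  have n1 : n.-1%:R = n%:R - 1 :> R by rewrite -subn1 natrB.
  case/orP: uv => /andP[/eqP-> /eqP->]; rewrite n1.
    by rewrite sub0r normrN ger0_norm // subr_ge0 ler1n.
  by rewrite subr0 ger0_norm // subr_ge0 ler1n.
by rewrite ler_pM2r ?invr_gt0 // ler_nat card_cycle_edges.
Qed.

End Cycle.

(** * The gap from the bounds 1/n, 2/n and 1 *)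

Theorem theorem1 (R : realType) (n : nat) (hn : (3 <= n)%N) :
  exists I : instance R 'I_n,
    unweighted I /\
    (0 < lp_opt I /\ (n%:R / 2)%:E * lp_opt I <= opt I) /\
    (0 < sdp_opt I /\ (n%:R / 2)%:E * sdp_opt I <= opt I).
Proof.
set I := cycle_instance R n hn.
have n_pos : (0 < n%:R :> R)%R by rewrite ltr0n (leq_trans _ hn).
have lp_gt0 : 0 < lp_opt I.
  apply: (@lt_le_trans _ _ (n%:R^-1)%:E); first by rewrite lte_fin invr_gt0.
  apply/ereal_infP => _ [d fd <-]; rewrite lee_fin.
  exact: cycle_lp_ge.
have lp_le_sdp : lp_opt I <= sdp_opt I := lp_opt_le_sdp_opt I.
have sdp_le : sdp_opt I <= (2 / n%:R)%:E.
  apply: ge_ereal_inf.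
  exists (max_over (sdp_cost I (interval_vector R n)))%:E.
    by exists (2 * n)%N, (interval_vector R n); split=> //;
      apply: interval_vector_feasible.
  by rewrite lee_fin interval_vector_cost.
have opt_ge : 1 <= opt I.
  apply/ereal_infP => _ [S cS <-]; rewrite lee_fin.
  exact: cycle_disagree_ge.
(* The factor n/2 scales the bound 2/n to 1, which is at most [opt I]; this serves both
   relaxations. *)
have gap x : x <= (2 / n%:R)%:E -> (n%:R / 2)%:E * x <= opt I.
  move=> x_le; apply: le_trans opt_ge.
  have -> : 1 = (n%:R / 2)%:E * (2 / n%:R)%:E :> \bar R.
    by rewrite -EFinM; congr EFin; field; rewrite gt_eqF.
  by rewrite lee_pmul2l // lte_fin divr_gt0.
exists I; split; first by [].
split; split=> //; last exact: gap.
- exact/gap/(le_trans lp_le_sdp).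
- exact: lt_le_trans lp_le_sdp.
Qed.
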